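(* Let $G$ be a finite simple connected graph with vertices $v_1,\ldots,v_n$ and $m$ edges, let $A(G)\subset V(G)\times V(G)$ be a set of arcs with $A(G)\cup A(G)^{-1}=D(G)$, and let $\theta: D(G)\to\mathbb{C}$ satisfy $\theta(e^{-1})=-\theta(e)$ for every $e\in A(G)$ and $\theta(e)=0$ for every $e\in A(G)\cap A(G)^{-1}$. Then \[ \det({\bf I}_{2m}-u{\bf U}_\theta)=(1-u^2)^{m-n}\det\big((1+u^2){\bf I}_n-2u\tilde{{\bf H}}_\theta\big)=\frac{(1-u^2)^{m-n}\det\big((1+u^2){\bf D}-2u{\bf H}_\theta\big)}{d_{v_1}\cdots d_{v_n}} . \]
   Context: $D(G)=\{(u,v),(v,u): uv\in E(G)\}$ is the set of $2m$ arcs of $G$; for $e=(u,v)$, $o(e)=u$, $t(e)=v$, $e^{-1}=(v,u)$, and $A(G)^{-1}=\{e^{-1}:e\in A(G)\}$. $d_v=\deg v$ is the degree of $v$ in $G$, ${\bf D}=\mathrm{diag}(d_{v_1},\ldots,d_{v_n})$, ${\bf D}^{-1/2}=\mathrm{diag}(d_{v_1}^{-1/2},\ldots,d_{v_n}^{-1/2})$. The $2m\times 2m$ matrix ${\bf S}_\theta$ (rows/columns indexed by $D(G)$) has $(e,f)$-entry $e^{i\theta(f)}$ if $f=e^{-1}$ and $0$ otherwise. The $n\times 2m$ matrix ${\bf K}$ has $(v,e)$-entry $1/\sqrt{\deg v}$ if $t(e)=v$ and $0$ otherwise; ${\bf C}=2{\bf K}^*{\bf K}-{\bf I}_{2m}$.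 The twisted Grover matrix is ${\bf U}_\theta={\bf S}_\theta{\bf C}$. The $n\times n$ generalized Hermitian adjacency matrix ${\bf H}_\theta$ has $(u,v)$-entry $1$ if $(u,v)\in A(G)\cap A(G)^{-1}$, $e^{i\theta(u,v)}$ if $(u,v)\in A(G)\setminus A(G)^{-1}$, $e^{-i\theta(v,u)}$ if $(u,v)\in A(G)^{-1}\setminus A(G)$, and $0$ otherwise; $\tilde{{\bf H}}_\theta={\bf D}^{-1/2}{\bf H}_\theta{\bf D}^{-1/2}$. *)

(* Defs.v *)
From HB Require Import structures.
From mathcomp Require Import all_boot all_order all_algebra.
From mathcomp Require Import complex reals.
From mathcomp Require Import sequences trigo.
Set Implicit Arguments.
Unset Strict Implicit.
Unset Printing Implicit Defensive.
Import Order.TTheory GRing.Theory Num.Theory.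
Local Open Scope ring_scope.
Local Open Scope complex_scope.

Record sgraph (V : finType) := SGraph {
  adj :> rel V;
  adj_sym : symmetric adj;
  adj_irrefl : irreflexive adj }.

Section Graph.
Variables (V : finType) (G : sgraph V).

Definition connected_graph : Prop := forall x y : V, connect G x y.

Definition deg (v : V) : nat := #|[set w | G v w]|.

(* D(G) *)
Definition arcs : {set V * V} := [set e | G e.1 e.2].

(* E(G) *)
Definition edges : {set {set V}} := [set [set e.1; e.2] | e in arcs].

(* o(e) = e.1 and t(e) = e.2 *)
Definition arc_inv (e : V * V) : V * V := (e.2, e.1).

Definition arcs_inv (A : {set V * V}) : {set V * V} := arc_inv @: A.

End Graph.

Definition cexp (R : realType) (z : R[i]) : R[i] :=
  (expR (complex.Re z))%:C * (cos (complex.Im z) +i* sin (complex.Im z)).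

(* Vertices are indexed by 'I_#|V| and arcs by 'I_#|arcs G| through enum_val,
   so n = #|V|, m = #|edges G| and 2m = #|arcs G|.  The function theta on D(G)
   is given as a function on V * V; only its values on arcs G are used. *)
Section Matrices.
Variables (R : realType) (V : finType) (G : sgraph V).
Variables (A : {set V * V}) (theta : V * V -> R[i]).

Local Notation C := R[i].

Definition S_mx : 'M[C]_#|arcs G| :=
  \matrix_(i, j)
    let e := enum_val i in let f := enum_val j in
    if f == arc_inv e then cexp ('i%C * theta f) else 0.

Definition K_mx : 'M[C]_(#|V|, #|arcs G|) :=
  \matrix_(i, j)
    let v := enum_val i in let e := enum_val j in
    if e.2 == v then (sqrtC (deg G v)%:R)^-1 else 0.

Definition C_mx : 'M[C]_#|arcs G| :=
  2%:R *: (map_mx Num.conj K_mx^T *m K_mx) - 1%:M.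

Definition U_mx : 'M[C]_#|arcs G| := S_mx *m C_mx.

Definition H_mx : 'M[C]_#|V| :=
  \matrix_(i, j)
    let e := (enum_val i, enum_val j) in
    if e \in A :&: arcs_inv A then 1
    else if e \in A :\: arcs_inv A then cexp ('i%C * theta e)
    else if e \in arcs_inv A :\: A then cexp (- ('i%C * theta (arc_inv e)))
    else 0.

Definition D_mx : 'M[C]_#|V| :=
  diag_mx (\row_i (deg G (enum_val i))%:R).

Definition Dinvsqrt_mx : 'M[C]_#|V| :=
  diag_mx (\row_i (sqrtC (deg G (enum_val i))%:R)^-1).

Definition Htilde_mx : 'M[C]_#|V| := Dinvsqrt_mx *m H_mx *m Dinvsqrt_mx.

End Matrices.

(* Main.v *)
Require Import Defs.
From mathcomp Require Import all_boot all_order all_algebra.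
From mathcomp Require Import complex reals.
From mathcomp Require Import sequences exp trigo.
From mathcomp Require Import ring.
Import Order.TTheory GRing.Theory Num.Theory.
Local Open Scope ring_scope.

(** Write [L] for the adjoint of [K].  Then [S^2 = 1], [K L = 1], and
    [K S L] is the normalized matrix [Htilde].  Multiplying [1 - x U] on the
    left by [1 - x S] gives [(1 - x^2) 1 - 2 x (S - x) L K], whose determinant is
    turned into an [n x n] one by exchanging the factors [L] and [K].  The
    factor [det (1 - x S) = (1 - x^2)^m] is found from an orientation of the
    edges, which conjugates [S] to [- S].  Everything is done with [x = 'X], so
    that powers of [1 - 'X^2] can be cancelled before evaluating at [u], even
    when [u^2 = 1]. *)

(** * Determinant identities over a commutative ring *)

Section Determinants.
Context {R : comNzRingType}.

(** Sylvester's identity in division-free form: column operations on [B] clear either its lower left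
    or its upper right block, and both sides equal [c ^+ n * \det B]. *)
Lemma det_scalar_sub_mul_comm {N n} (c : R) (M : 'M[R]_(N, n))
    (K : 'M[R]_(n, N)) :
  c ^+ n * \det (c%:M - M *m K) = c ^+ N * \det (c%:M - K *m M).
Proof.
pose B := block_mx c%:M M K 1%:M.
have detB : \det B = \det (c%:M - M *m K).
  transitivity (\det (B *m block_mx 1%:M 0 (- K) 1%:M)).
    by rewrite det_mulmx det_lblock !det1 !mulr1.
  rewrite mulmx_block !mulmx0 !mulmx1 !add0r mulmxN mul1mx subrr.
  by rewrite det_ublock det1 mulr1.
have: \det (B *m block_mx 1%:M (- M) 0 c%:M) = c ^+ N * \det (c%:M - K *m M).
  rewrite mulmx_block !mulmx0 !mulmx1 !addr0 !mulmxN mul1mx mul_scalar_mx.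
  by rewrite mul_mx_scalar addNr det_lblock det_scalar addrC.
by rewrite det_mulmx det_ublock det1 mul1r det_scalar detB mulrC.
Qed.

Lemma involution_mul_scalar {N} (S : 'M[R]_N) (x : R) :
  S *m S = 1%:M -> (1%:M - x *: S) *m (1%:M + x *: S) = (1 - x ^+ 2)%:M.
Proof.
move=> SS; rewrite mulmxDr mulmx1 -scalemxAr mulmxBl mul1mx -scalemxAl SS.
by rewrite scalerBr scalerA addrA subrK -expr2 raddfB /= scalemx1.
Qed.

Lemma det_sub_involution_mul {N n} (S : 'M[R]_N) (K : 'M[R]_(n, N))
    (L : 'M[R]_(N, n)) (x : R) :
  S *m S = 1%:M -> K *m L = 1%:M ->
  (1 - x ^+ 2) ^+ n * (\det (1%:M - x *: S)
     * \det (1%:M - x *: (S *m (2%:R *: (L *m K) - 1%:M))))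
  = (1 - x ^+ 2) ^+ N
    * \det ((1 + x ^+ 2)%:M - (2%:R * x) *: (K *m S *m L)).
Proof.
move=> SS KL; rewrite -det_mulmx.
pose M := (2%:R * x) *: ((S - x%:M) *m L).
have -> : (1%:M - x *: S) *m (1%:M - x *: (S *m (2%:R *: (L *m K) - 1%:M)))
          = (1 - x ^+ 2)%:M - M *m K.
  have -> : 1%:M - x *: (S *m (2%:R *: (L *m K) - 1%:M))
            = (1%:M + x *: S) - (2%:R * x) *: (S *m L *m K).
    rewrite mulmxBr mulmx1 scalerBr opprB -scalemxAr scalerA mulmxA.
    by rewrite [x * _]mulrC addrA.
  rewrite mulmxBr involution_mul_scalar //; congr (_ - _).
  rewrite /M -scalemxAr -!scalemxAl; congr (_ *: _).
  rewrite !mulmxA; congr (_ *m _ *m _).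
  by rewrite mulmxBl mul1mx -scalemxAl SS scalemx1.
rewrite det_scalar_sub_mul_comm; congr (_ * \det _).
(* As [K L = 1], the summand [- x] of [S - x] contributes [2 x^2], turning [1 - x^2] into
   [1 + x^2]. *)
rewrite /M -scalemxAr mulmxA mulmxBr mulmxBl mul_mx_scalar -scalemxAl KL.
rewrite scalerBr scalerA opprB addrA scalemx1 -raddfD /=.
by congr (_%:M - _); ring.
Qed.

End Determinants.

(** * Polynomial identities in ['X] and their evaluation *)

Section InvolutionDeterminants.
Context {F : idomainType}.

Lemma one_sub_X2_neq0 : 1 - 'X^2 != 0 :> {poly F}.
Proof. by rewrite -opprB oppr_eq0 -size_poly_eq0 size_XnsubC. Qed.

Lemma horner_det {N} (M : 'M[{poly F}]_N) (u : F) :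
  (\det M).[u] = \det (map_mx (horner_eval u) M).
Proof. by rewrite det_map_mx. Qed.

(* Conjugation by [E] swaps [1 - x S] and [1 + x S], whose product is
   [(1 - x^2) I]; the sign of the square root is fixed at [x = 0]. *)
Lemma det_sub_involution {N m} (S E : 'M[F]_N) (char2 : 2%:R != 0 :> F) :
  N = m.*2 -> S *m S = 1%:M -> E *m E = 1%:M -> E *m S *m E = - S ->
  \det (1%:M - 'X *: map_mx polyC S) = (1 - 'X^2) ^+ m.
Proof.
move=> Nm SS EE ESE; set T := map_mx polyC S; set p := \det _.
have TT : T *m T = 1%:M by rewrite -map_mxM SS map_mx1.
pose W := map_mx polyC E.
have WW : W *m W = 1%:M by rewrite -map_mxM EE map_mx1.
have WTW : W *m T *m W = - T by rewrite -!map_mxM ESE map_mxN.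
have pE : \det (1%:M + 'X *: T) = p.
  have -> : 1%:M + 'X *: T = W *m (1%:M - 'X *: T) *m W.
    rewrite mulmxBr mulmx1 mulmxBl WW -scalemxAr -scalemxAl WTW.
    by rewrite scalerN opprK.
  by rewrite !det_mulmx mulrAC -det_mulmx WW det1 mul1r.
have: p ^+ 2 = ((1 - 'X^2) ^+ m) ^+ 2.
  rewrite expr2 -{2}pE -det_mulmx involution_mul_scalar // det_scalar Nm.
  by rewrite -exprM muln2.
move/eqP; rewrite eqf_sqr => /orP[/eqP // | /eqP pN].
have := congr1 (fun q => q.[0]) pN; rewrite horner_det.
rewrite map_mxB map_mxZ map_mx1 /= /horner_eval !hornerE expr0n /= subr0.
rewrite expr1n scale0r subr0 det1 => /eqP.
by rewrite -subr_eq0 opprK -[1 + 1]/(2%:R) (negPf char2).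
Qed.

Section Evolution.
Context {N n m : nat} {S E : 'M[F]_N} {K : 'M[F]_(n, N)} {L : 'M[F]_(N, n)}.
Hypotheses (char2 : 2%:R != 0 :> F) (Nm : N = m.*2).
Hypotheses (SS : S *m S = 1%:M) (EE : E *m E = 1%:M) (ESE : E *m S *m E = - S).
Hypothesis KL : K *m L = 1%:M.

Let P : {poly F} :=
  \det (1%:M - 'X *: map_mx polyC (S *m (2%:R *: (L *m K) - 1%:M))).
Let Q : {poly F} :=
  \det ((1 + 'X^2)%:M - (2%:R * 'X) *: map_mx polyC (K *m S *m L)).

(** A factor [(1 - 'X^2) ^+ m] cancels: on the left it is [\det (1 - 'X S)], on the right half of
    the exponent [N = 2 m]. *)
Let PQ : (1 - 'X^2) ^+ n * P = (1 - 'X^2) ^+ m * Q.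
Proof.
apply: (mulfI (expf_neq0 m one_sub_X2_neq0)).
have SS' : map_mx polyC S *m map_mx polyC S = 1%:M.
  by rewrite -map_mxM SS map_mx1.
have KL' : map_mx polyC K *m map_mx polyC L = 1%:M.
  by rewrite -map_mxM KL map_mx1.
have := det_sub_involution_mul _ _ _ 'X SS' KL'.
have cN : (1 - 'X^2) ^+ N = (1 - 'X^2) ^+ m * (1 - 'X^2) ^+ m :> {poly F}.
  by rewrite -exprD addnn -Nm.
rewrite (det_sub_involution S E char2 Nm SS EE ESE) cN mulrCA.
rewrite -[in X in _ = X -> _]mulrA /P /Q !map_mxM => <-.
by rewrite map_mxB map_mxZ map_mxM map_mx1 /= rmorph_nat.
Qed.

Let P_eval u : P.[u] = \det (1%:M - u *: (S *m (2%:R *: (L *m K) - 1%:M))).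
Proof.
rewrite horner_det map_mxB map_mxZ map_mx1 /= /horner_eval hornerX.
by rewrite -map_mx_comp map_mx_id // => c; rewrite /= hornerC.
Qed.

Let Q_eval u :
  Q.[u] = \det ((1 + u ^+ 2)%:M - (2%:R * u) *: (K *m S *m L)).
Proof.
rewrite horner_det map_mxB map_mxZ map_scalar_mx /= /horner_eval !hornerE.
by rewrite -map_mx_comp map_mx_id => [|c]; rewrite ?/= ?hornerC.
Qed.

Lemma det_evolution_mul (u : F) :
  (1 - u ^+ 2) ^+ n * \det (1%:M - u *: (S *m (2%:R *: (L *m K) - 1%:M)))
  = (1 - u ^+ 2) ^+ m
    * \det ((1 + u ^+ 2)%:M - (2%:R * u) *: (K *m S *m L)).
Proof.
rewrite -P_eval -Q_eval; have := congr1 (fun q => q.[u]) PQ.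
by rewrite !hornerE.
Qed.

(** Here [(1 - 'X^2) ^+ n] is cancelled between polynomials, where it is never zero, so [u^2 = 1] is
    covered. *)
Lemma det_evolution_le (u : F) : (n <= m)%N ->
  \det (1%:M - u *: (S *m (2%:R *: (L *m K) - 1%:M)))
  = (1 - u ^+ 2) ^+ (m - n)
    * \det ((1 + u ^+ 2)%:M - (2%:R * u) *: (K *m S *m L)).
Proof.
move=> nm; have PE : P = (1 - 'X^2) ^+ (m - n) * Q.
  apply: (mulfI (expf_neq0 n one_sub_X2_neq0)).
  by rewrite PQ mulrA -exprD subnKC.
rewrite -P_eval -Q_eval PE.
by rewrite !hornerE.
Qed.

End Evolution.
End InvolutionDeterminants.

Lemma det_evolution (F : fieldType) N n m (S E : 'M[F]_N) (K : 'M[F]_(n, N))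
    (L : 'M[F]_(N, n)) (u : F) :
  2%:R != 0 :> F -> N = m.*2 ->
  S *m S = 1%:M -> E *m E = 1%:M -> E *m S *m E = - S -> K *m L = 1%:M ->
  ((m < n)%N -> 1 - u ^+ 2 != 0) ->
  \det (1%:M - u *: (S *m (2%:R *: (L *m K) - 1%:M)))
  = (1 - u ^+ 2) ^ (m%:Z - n%:Z)
    * \det ((1 + u ^+ 2)%:M - (2%:R * u) *: (K *m S *m L)).
Proof.
move=> char2 Nm SS EE ESE KL u_def; case: (leqP n m) => [nm|mn].
  by rewrite (det_evolution_le char2 Nm SS EE ESE KL) // subzn.
(* The exponent is negative here, so the division takes place in the field, after evaluation. *)
have c0 := u_def mn; apply: (mulfI (expf_neq0 n c0)).
rewrite (det_evolution_mul char2 Nm SS EE ESE KL) mulrA; congr (_ * _).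
by rewrite !exprnP -expfzDr // [n%:Z + _]addrC subrK.
Qed.

(** * The complex exponential *)

Section Cexp.
Variable R : realType.
Implicit Types z : R[i].

Lemma cexp0 : cexp (0 : R[i]) = 1.
Proof. by rewrite /cexp /= expR0 cos0 sin0 mulr1. Qed.

(** Since [theta] may be non-real, phases need not have modulus one; this inverse law is what makes
    [S] an involution. *)
Lemma cexpNK z : cexp (- z) * cexp z = 1.
Proof.
case: z => a b; rewrite /cexp /= expRN cosN sinN.
have ea : expR a != 0 by rewrite gt_eqF ?expR_gt0.
apply/eqP; rewrite eq_complex /=; apply/andP; split; apply/eqP; last by ring.
transitivity ((expR a)^-1 * expR a * (cos b ^+ 2 + sin b ^+ 2)); first by ring.
by rewrite cos2Dsin2 mulr1 mulVf.
Qed.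

End Cexp.

(** * Arcs, degrees and an orientation of the edges *)

Section GraphFacts.
Variables (V : finType) (G : sgraph V).

Lemma arc_invK : involutive (@arc_inv V).
Proof. by case. Qed.

Lemma in_arcs_inv (A : {set V * V}) e : (e \in arcs_inv A) = (arc_inv e \in A).
Proof. by rewrite -{1}[e]arc_invK mem_imset //; apply: inv_inj arc_invK. Qed.

Lemma arc_inv_arcs e : (arc_inv e \in arcs G) = (e \in arcs G).
Proof. by rewrite !inE /= adj_sym. Qed.

(** A path from [v] to some other vertex starts with an edge at [v]. *)
Lemma deg_gt0 v : connected_graph G -> (1 < #|V|)%N -> (0 < deg G v)%N.
Proof.
move=> Gc /card_gt1P[x [y [_ _ xy]]].
have [w vw] : exists w, v != w.
  by case: (eqVneq v x) => [->|vx]; [exists y | exists x].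
case/connectP: (Gc v w) => [[|z p] /= pth wE].
  by rewrite wE eqxx in vw.
by case/andP: pth => vz _; apply/card_gt0P; exists z; rewrite inE.
Qed.

(** The enumeration of [V] serves as a total order that selects one arc of each edge. *)
Definition forward_arc (e : V * V) : bool := (enum_rank e.1 < enum_rank e.2)%N.

Lemma forward_arc_inv e : e \in arcs G ->
  forward_arc (arc_inv e) = ~~ forward_arc e.
Proof.
case: e => x y; rewrite inE /= => xy; rewrite /forward_arc /= -leqNgt ltn_neqAle.
rewrite -[X in X && _]negbK; case: eqP => //= /val_inj/enum_rank_inj yx.
by rewrite yx adj_irrefl in xy.
Qed.

(** Each edge is the endpoint set of exactly one forward arc, and reversal matches forward with
    backward arcs. *)
Lemma card_arcs : #|arcs G| = #|edges G|.*2.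
Proof.
pose Fw := [set e in arcs G | forward_arc e].
pose Bw := [set e in arcs G | ~~ forward_arc e].
have BF : Bw = @arc_inv V @: Fw.
  apply/setP=> e; rewrite -/(arcs_inv Fw) in_arcs_inv [LHS]in_set [RHS]in_set.
  rewrite arc_inv_arcs.
  by case: (boolP (e \in arcs G)) => // /forward_arc_inv ->.
have EF : edges G = [set [set e.1; e.2] | e in Fw].
  apply/setP=> s; apply/imsetP/imsetP => [[e eG ->]|[e]]; last first.
    by rewrite inE => /andP[eG _] ->; exists e.
  case: (boolP (forward_arc e)) => ef; first by exists e; rewrite // inE eG.
  exists (arc_inv e); last by rewrite setUC.
  by rewrite inE arc_inv_arcs eG forward_arc_inv.
have cE : #|edges G| = #|Fw|.
  rewrite EF card_in_imset // => -[x y] [z t]; rewrite !inE /forward_arc /=.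
  move=> /andP[_ xy] /andP[_ zt] /setP eq.
  (* Both [x] and [y] lie in [{z, t}]; with both arcs forward, only [x = z], [y = t] survives. *)
  move: (eq x) (eq y) (eq z) (eq t); rewrite !inE !eqxx ?orbT /=.
  move=> /esym/orP[] /eqP ? /esym/orP[] /eqP ? _ _; subst => //.
  - by rewrite ltnn in xy.
  - by have := ltn_trans xy zt; rewrite ltnn.
  - by rewrite ltnn in xy.
rewrite -(cardsID [set e | forward_arc e]) cE -addnn; congr (_ + _)%N.
  by apply: eq_card => e; rewrite !inE.
rewrite -(card_imset Fw (inv_inj arc_invK)) -BF.
by apply: eq_card => e; rewrite !inE andbC.
Qed.

End GraphFacts.

(** * The matrices of the twisted Grover walk *)

Section GroverMatrices.
Variables (R : realType) (V : finType) (G : sgraph V).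
Variables (A : {set V * V}) (theta : V * V -> R[i]).
Hypotheses (A_arcs : A :|: arcs_inv A = arcs G)
  (theta_inv : forall e, e \in A -> theta (arc_inv e) = - theta e)
  (theta_0 : forall e, e \in A :&: arcs_inv A -> theta e = 0)
  (deg0 : forall v, (0 < deg G v)%N).

Local Notation C := R[i].
Local Notation S := (S_mx G theta).
Local Notation K := (K_mx R G).
Local Notation Kstar := (map_mx Num.conj K^T).

Let ph (e : V * V) : C := cexp ('i%C * theta e).
Let sq (v : V) : C := sqrtC (deg G v)%:R.

Lemma sum_arcs (f : V * V -> C) :
  \sum_(i < #|arcs G|) f (enum_val i) = \sum_(e in arcs G) f e.
Proof. by rewrite [RHS]big_enum_val. Qed.

(** An arc outside [A] has its reverse in [A], and the sign rule is symmetric under reversal. *)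
Lemma theta_arc_inv e : e \in arcs G -> theta (arc_inv e) = - theta e.
Proof.
rewrite -A_arcs inE in_arcs_inv => /orP[/theta_inv //|/theta_inv].
by rewrite arc_invK => ->; rewrite opprK.
Qed.

Lemma sqrt_deg_neq0 v : sq v != 0.
Proof. by rewrite sqrtC_eq0 pnatr_eq0 -lt0n. Qed.

(** Row [e] of [S] is supported at the reverse of [e], so the square is diagonal, and the two phases
    met are inverse to each other. *)
Lemma S_mx_sqr : S *m S = 1%:M.
Proof.
apply/matrixP=> i j; rewrite !mxE.
under eq_bigr do rewrite !mxE.
rewrite (sum_arcs (fun e => (if e == arc_inv (enum_val i) then ph e else 0)
  * (if enum_val j == arc_inv e then ph (enum_val j) else 0))).
have iG : enum_val i \in arcs G := enum_valP i.
rewrite (bigD1 (arc_inv (enum_val i))) ?arc_inv_arcs //= eqxx arc_invK.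
rewrite big1 ?addr0; last first.
  by move=> e /andP[_ /negPf ->]; rewrite mul0r.
rewrite (inj_eq enum_val_inj) [j == i]eq_sym; case: eqP => [<-|_].
  by rewrite /ph theta_arc_inv // mulrN cexpNK.
by rewrite mulr0.
Qed.

Lemma conj_inv_sqrt_deg v : Num.conj (sq v)^-1 = (sq v)^-1.
Proof. by apply: conj_Creal; rewrite ger0_real // invr_ge0 sqrtC_ge0 ler0n. Qed.

Lemma K_mxE i j :
  K i j = if (enum_val j).2 == enum_val i then (sq (enum_val i))^-1 else 0.
Proof. by rewrite mxE. Qed.

Lemma Kstar_mxE i j :
  Kstar i j = if (enum_val i).2 == enum_val j then (sq (enum_val j))^-1 else 0.
Proof.
rewrite !mxE; case: ifP => _; [exact: conj_inv_sqrt_deg|exact: conjC0].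
Qed.

Lemma card_arcs_target v : #|[set e in arcs G | e.2 == v]| = deg G v.
Proof.
rewrite /deg -(card_imset [set w | G v w] (f := fun w => (w, v))); last first.
  by move=> x y [].
apply: eq_card => -[x y]; rewrite !inE /=; apply/andP/imsetP => [[xy /eqP yv]|].
  by exists x; rewrite ?inE -?yv // adj_sym.
by case=> w; rewrite inE adj_sym => vw [-> ->].
Qed.

(** An arc has one target, so distinct rows of [K] have disjoint supports; row [v] has [deg G v]
    entries of square [1 / deg G v]. *)
Lemma K_mul_Kstar : K *m Kstar = 1%:M.
Proof.
apply/matrixP=> i j; rewrite !mxE.
under eq_bigr do rewrite K_mxE Kstar_mxE.
rewrite (sum_arcs (fun e => (if e.2 == enum_val i then (sq (enum_val i))^-1 else 0)
  * (if e.2 == enum_val j then (sq (enum_val j))^-1 else 0))).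
have [<-|ij] := eqVneq i j; last first.
  rewrite big1 // => e _; case: eqP => [->|]; last by rewrite mul0r.
  by rewrite (inj_eq enum_val_inj) (negPf ij) mulr0.
rewrite (bigID (fun e => e.2 == enum_val i)) /= addrC big1 ?add0r; last first.
  by move=> e /andP[_ /negPf ->]; rewrite mul0r.
rewrite (eq_bigr (fun=> (sq (enum_val i))^-1 ^+ 2)); last first.
  by move=> e /andP[_ ->]; rewrite expr2.
rewrite sumr_const exprVn sqrtCK.
have -> : #|(fun e => (e \in arcs G) && (e.2 == enum_val i))| = deg G (enum_val i).
  by rewrite -card_arcs_target; apply: eq_card => e; rewrite [RHS]in_set.
by rewrite -[LHS]mulr_natr mulVf // pnatr_eq0 -lt0n.
Qed.

(** The conditions on [theta] merge the three nonzero cases into one phase: it is 1 where [theta]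
    vanishes, and the sign rule handles arcs outside [A]. *)
Lemma H_mxE i j : H_mx A theta i j =
  if G (enum_val i) (enum_val j) then ph (enum_val i, enum_val j) else 0.
Proof.
rewrite mxE /=; set e := (_, _).
have -> : G (enum_val i) (enum_val j) = (e \in arcs G) by rewrite inE.
case: ifP => [eAA|].
  have eA : e \in A by move: eAA; rewrite in_setI => /andP[].
  by rewrite -A_arcs in_setU eA /ph theta_0 // mulr0 cexp0.
rewrite -A_arcs in_setI !in_setD in_setU; case: (boolP (e \in A)) => /= [_ -> //|_ _].
case eB: (e \in arcs_inv A) => //=.
by rewrite /ph -mulrN -theta_inv ?arc_invK -?in_arcs_inv.
Qed.

(** Entry [(x, y)] sums over arcs from [x] to [y], and a simple graph has at most one. *)
Lemma K_S_Kstar : K *m S *m Kstar = Htilde_mx G A theta.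
Proof.
apply/matrixP=> i j.
have -> : Htilde_mx G A theta i j
    = (sq (enum_val i))^-1 * H_mx A theta i j * (sq (enum_val j))^-1.
  rewrite /Htilde_mx mul_mx_diag mxE mul_diag_mx mxE.
  by congr (_ * _ * _); rewrite mxE.
rewrite H_mxE mxE; set x := enum_val i; set y := enum_val j.
(* [S] reverses arcs, so the target test in [K] becomes a test on the origin. *)
have KS k : (K *m S) i k =
    if (enum_val k).1 == x then (sq x)^-1 * ph (enum_val k) else 0.
  rewrite mxE; under eq_bigr do rewrite K_mxE mxE.
  rewrite (sum_arcs (fun e => (if e.2 == x then (sq x)^-1 else 0)
    * (if enum_val k == arc_inv e then ph (enum_val k) else 0))).
  rewrite (bigD1 (arc_inv (enum_val k))) ?arc_inv_arcs ?enum_valP //=.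
  rewrite arc_invK eqxx big1 ?addr0; last first.
    move=> e /andP[_ ek]; case: (enum_val k =P _) => [eE|]; last by rewrite mulr0.
    by rewrite eE arc_invK eqxx in ek.
  by case: ifP => // _; rewrite mul0r.
under eq_bigr do rewrite KS Kstar_mxE.
rewrite (sum_arcs (fun e => (if e.1 == x then (sq x)^-1 * ph e else 0)
    * (if e.2 == y then (sq y)^-1 else 0))).
case: ifP => xy; last first.
  rewrite mulr0 mul0r big1 // => -[a b]; rewrite inE /= => ab.
  case: eqP => [ax|]; last by rewrite mul0r.
  case: eqP => [bY|]; last by rewrite mulr0.
  by rewrite -ax -bY ab in xy.
rewrite (bigD1 (x, y)) ?inE //= !eqxx big1 ?addr0 // => -[a b] /= /andP[_].
rewrite xpair_eqE; case: eqP => [_|]; last by rewrite mul0r.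
by case: eqP => //; rewrite mulr0.
Qed.

Definition orientation_mx : 'M[C]_#|arcs G| :=
  diag_mx (\row_i (-1) ^+ forward_arc V (enum_val i)).

Lemma orientation_mx_sqr : orientation_mx *m orientation_mx = 1%:M.
Proof.
apply/matrixP=> i j; rewrite mul_diag_mx !mxE.
case: eqP => [->|_]; last by rewrite mulr0n mulr0.
by rewrite mulr1n -expr2 sqrr_sign.
Qed.

(** [S] only links an arc to its reverse, and these carry opposite signs. *)
Lemma orientation_conj_S : orientation_mx *m S *m orientation_mx = - S.
Proof.
apply/matrixP=> i j; rewrite mul_mx_diag mxE mul_diag_mx !mxE /=.
case: eqP => [->|_]; last by rewrite mulr0 mul0r oppr0.
rewrite (@forward_arc_inv _ G) ?enum_valP // mulrAC.
by case: forward_arc; rewrite ?expr0 ?expr1 ?mulr1 ?mul1r mulN1r.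
Qed.

Lemma det_Dinvsqrt_sqr :
  \det (Dinvsqrt_mx R G) ^+ 2 = (\prod_(v : V) (deg G v)%:R)^-1.
Proof.
rewrite det_diag -prodrXl -prodfV [RHS](reindex (@enum_val V V)) /=; last first.
  by apply: onW_bij; apply: enum_val_bij.
by apply: eq_bigr => i _; rewrite mxE exprVn sqrtCK.
Qed.

(** The left matrix is [a D - b H] multiplied on both sides by [D^(-1/2)]. *)
Lemma det_Htilde (a b : C) :
  \det (a%:M - b *: Htilde_mx G A theta)
  = \det (a *: D_mx R G - b *: H_mx A theta) / \prod_(v : V) (deg G v)%:R.
Proof.
rewrite -det_Dinvsqrt_sqr expr2 mulrCA mulrA -!det_mulmx; congr (\det _).
rewrite mulmxBr mulmxBl -!scalemxAr -!scalemxAl; congr (_ - _).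
rewrite -scalemx1; congr (_ *: _).
apply/matrixP=> i j; rewrite mul_mx_diag mxE mul_diag_mx !mxE.
case: eqP => [->|_]; last by rewrite mulr0n mulr0 mul0r.
rewrite !mulr1n -{2}(sqrtCK (deg G _)%:R) expr2 mulrA mulVf ?mul1r ?mulfV //;
  exact: sqrt_deg_neq0.
Qed.

End GroverMatrices.

(** [V_gt1] makes all degrees positive, so that [D] is invertible; [u_def] excludes dividing by zero
    when the exponent [m - n] is negative, which for a connected graph means a tree. *)
Theorem theorem8 (R : realType) (V : finType) (G : sgraph V)
    (A : {set V * V}) (theta : V * V -> R[i]) (u : R[i])
    (G_conn : connected_graph G)
    (V_gt1 : (1 < #|V|)%N)
    (A_arcs : A :|: arcs_inv A = arcs G)
    (theta_inv : forall e, e \in A -> theta (arc_inv e) = - theta e)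
    (theta_0 : forall e, e \in A :&: arcs_inv A -> theta e = 0)
    (u_def : (#|edges G| < #|V|)%N -> 1 - u ^+ 2 != 0) :
  let n := #|V| in
  let m := #|edges G| in
  \det (1%:M - u *: U_mx G theta)
    = (1 - u ^+ 2) ^ (m%:Z - n%:Z)
      * \det ((1 + u ^+ 2)%:M - (2%:R * u) *: Htilde_mx G A theta)
  /\
  (1 - u ^+ 2) ^ (m%:Z - n%:Z)
      * \det ((1 + u ^+ 2)%:M - (2%:R * u) *: Htilde_mx G A theta)
    = (1 - u ^+ 2) ^ (m%:Z - n%:Z)
      * \det ((1 + u ^+ 2) *: D_mx R G - (2%:R * u) *: H_mx A theta)
      / \prod_(v : V) (deg G v)%:R.
Proof.
move=> n m; have deg0 v : (0 < deg G v)%N by apply: deg_gt0.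
split; last by rewrite -mulrA det_Htilde.
rewrite -(K_S_Kstar _ _ _ _ theta A_arcs theta_inv theta_0).
apply: (det_evolution _ _ _ m _ (orientation_mx R V G)) => //.
- by rewrite pnatr_eq0.
- exact: card_arcs.
- exact: S_mx_sqr A_arcs theta_inv.
- exact: orientation_mx_sqr.
- exact: orientation_conj_S.
- exact: K_mul_Kstar.
Qed.
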